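(* Let $G_1$ and $G_2$ be nonempty simple graphs of orders $N_1$ and $N_2$, respectively. Let $0=\alpha_1\le\alpha_2\le\cdots\le\alpha_{N_1}$ and $0=\beta_1\le\beta_2\le\cdots\le\beta_{N_2}$ be the Laplacian eigenvalues (with multiplicity) of $G_1$ and $G_2$, respectively, and let $N=N_1+N_2$. Let $\widetilde K$ denote the Açıkmeşe lift of $K=\widehat{G_1}\vee\widehat{G_2}$. Then, for every $t>0$, $$\chi_t^{\widetilde K}(g)=1+e^{-(2N+1)t}-e^{-t}$$ and $$\chi_t^{\widetilde K}(1)=1+e^{-(2N+1)t}+e^{-t}+2e^{-(N+1)t}+2\sum_{i=2}^{N_1}e^{-(\alpha_i+N_2+1)t}+2\sum_{j=2}^{N_2}e^{-(\beta_j+N_1+1)t}.$$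
   Context: Graphs are finite and undirected; ''nonempty'' means having at least one vertex. For a simple graph $G$, $\widehat G$ denotes its full-loop graph: one loop is attached at every vertex. The join $\widehat{G_1}\vee\widehat{G_2}$ is the disjoint union of $\widehat{G_1}$ and $\widehat{G_2}$ (keeping all loops) together with all edges between a vertex of $G_1$ and a vertex of $G_2$; it is thus the full-loop graph of the join $G_1\vee G_2$. Laplacian eigenvalues of a simple graph $G$ are those of $\mathcal{L}(G)=D(G)-A(G)$. A self-loop graph $G_S$ is obtained from a simple graph $G$ on $\{1,\dots,N\}$ by attaching one loop at every vertex of $S\subseteq\{1,\dots,N\}$. For $|S|\ge1$, its Açıkmeşe lift $\widetilde G$ is the simple graph on $\{1,\dots,2N+1\}$ such that: for each edge $\{i,j\}$ of $G$, both $\{i,j\}$ and $\{i+N+1,j+N+1\}$ are edges of $\widetilde G$; for each $i\in S$, both $\{i,N+1\}$ and $\{N+1,i+N+1\}$ are edges; there are no other edges. The involution matrix $T$ is the $(2N+1)\times(2N+1)$ permutation matrix of the map swapping $i\leftrightarrow i+N+1$ ($1\le i\le N$) and fixing $N+1$. With $\mathbb{Z}_2=\{1,g\}$, the equivariant heat character is $\chi_t^{\widetilde G}(1)=\mathrm{Tr}(e^{-t\mathcal{L}(\widetilde G)})$, $\chi_t^{\widetilde G}(g)=\mathrm{Tr}(e^{-t\mathcal{L}(\widetilde G)}T)$ for $t>0$, where $\mathcal{L}(\widetilde G)$ is the ordinary Laplacian of $\widetilde G$. *)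

(* Defs.v *)
From HB Require Import structures.
From mathcomp Require Import all_boot all_order all_fingroup all_algebra.
From mathcomp Require Import all_classical all_reals all_analysis.
Set Implicit Arguments.
Unset Strict Implicit.
Unset Printing Implicit Defensive.
Import Order.TTheory GRing.Theory Num.Theory.
Import numFieldNormedType.Exports.
Local Open Scope ring_scope.

Record sgraph (n : nat) := SGraph {
  adj :> rel 'I_n;
  adj_sym : symmetric adj;
  adj_irr : irreflexive adj }.

Record loop_graph (n : nat) := LoopGraph {
  base : sgraph n;
  loops : {set 'I_n} }.

Definition full_loop n (G : sgraph n) : loop_graph n := LoopGraph G [set: 'I_n]%SET.

Definition join_rel m n (G : sgraph m) (H : sgraph n) : rel 'I_(m + n) :=
  fun u v => match fintype.split u, fintype.split v with
             | inl i, inl j => G i j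
             | inr i, inr j => H i j
             | _, _ => true
             end.

Lemma join_rel_sym m n (G : sgraph m) (H : sgraph n) :
  symmetric (join_rel G H).
Proof.
by move=> u v; rewrite /join_rel; case: fintype.split => i; case: fintype.split => j //;
  rewrite adj_sym.
Qed.

Lemma join_rel_irr m n (G : sgraph m) (H : sgraph n) :
  irreflexive (join_rel G H).
Proof. by move=> u; rewrite /join_rel; case: fintype.split => i; rewrite adj_irr. Qed.

Definition graph_join m n (G : sgraph m) (H : sgraph n) : sgraph (m + n) :=
  SGraph (join_rel_sym G H) (join_rel_irr G H).

Definition loop_join m n (K : loop_graph m) (L : loop_graph n) :
    loop_graph (m + n) :=
  LoopGraph (graph_join (base K) (base L))
    [set u | match fintype.split u with
             | inl i => i \in loops K
             | inr j => j \in loops L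
             end]%SET.

Lemma loop_join_full m n (G : sgraph m) (H : sgraph n) :
  loop_join (full_loop G) (full_loop H) = full_loop (graph_join G H).
Proof.
congr LoopGraph; apply/setP => u; rewrite !inE.
by case: fintype.split => i; rewrite inE.
Qed.

(* The 2N+1 vertices of the lift are 'I_(N + (1 + N)). With numbering from 0,
   [Copy1 i], [Middle] and [Copy2 i] are the vertices i, N and i + N + 1. *)
Variant lift_vertex (N : nat) := Copy1 of 'I_N | Middle | Copy2 of 'I_N.

Definition lift_view N (u : 'I_(N + (1 + N))) : lift_vertex N :=
  match fintype.split u with
  | inl i => Copy1 i
  | inr w => match fintype.split w with inl _ => Middle N | inr i => Copy2 i end
  end.

Definition lift_rel N (K : loop_graph N) : rel 'I_(N + (1 + N)) :=
  fun u v => match lift_view u, lift_view v with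
             | Copy1 i, Copy1 j | Copy2 i, Copy2 j => base K i j
             | Copy1 i, Middle | Middle, Copy1 i
             | Copy2 i, Middle | Middle, Copy2 i => i \in loops K
             | _, _ => false
             end.

Lemma lift_rel_sym N (K : loop_graph N) : symmetric (lift_rel K).
Proof.
by move=> u v; rewrite /lift_rel; case: lift_view => [i||i];
  case: lift_view => [j||j] //; rewrite adj_sym.
Qed.

Lemma lift_rel_irr N (K : loop_graph N) : irreflexive (lift_rel K).
Proof.
by move=> u; rewrite /lift_rel; case: lift_view => [i||i] //; rewrite adj_irr.
Qed.

(* The construction is total in K; the literature reserves it for K with at
   least one loop. *)
Definition acikmese_lift N (K : loop_graph N) : sgraph (N + (1 + N)) :=
  SGraph (lift_rel_sym K) (lift_rel_irr K).

Definition lift_swap N (u : 'I_(N + (1 + N))) : 'I_(N + (1 + N)) :=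
  match lift_view u with
  | Copy1 i => rshift N (rshift 1 i)
  | Middle => u
  | Copy2 i => lshift (1 + N) i
  end.

Lemma lift_swapK N : involutive (@lift_swap N).
Proof.
move=> u; rewrite /lift_swap /lift_view.
case: (split_ordP u) => [i ->|w ->].
  by rewrite (unsplitK (inr _)) (unsplitK (inr _)).
case: (split_ordP w) => [k ->|i ->].
  by rewrite (unsplitK (inr _)) (unsplitK (inl _)).
by rewrite (unsplitK (inl _)).
Qed.

Section Spectral.
Variable R : realType.
Local Open Scope classical_set_scope.

Definition laplacian n (G : sgraph n) : 'M[R]_n :=
  diag_mx (\row_i #|[set j | G i j]%SET|%:R) - \matrix_(i, j) (G i j)%:R.

(* Eigenvalues with multiplicity, in nondecreasing order. *)
Definition spectrum_of n (A : 'M[R]_n) (s : n.-tuple R) : Prop :=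
  sorted <=%R s /\ char_poly A = \prod_(a <- s) ('X - a%:P).

Definition expmx n (A : 'M[R]_n) : 'M[R]_n :=
  limn (series (fun k => (k`!%:R)^-1 *: (A ^+ k))).

Definition involution_mx N : 'M[R]_(N + (1 + N)) :=
  perm_mx (perm (inv_inj (@lift_swapK N))).

End Spectral.

(* The group {1, g} of order two, in multiplicative notation. *)
Variant Z2 := Z2_1 | Z2_g.

Definition heat_character (R : realType) N (K : loop_graph N) (t : R)
    (h : Z2) : R :=
  let heat := expmx (- t *: laplacian R (acikmese_lift K)) in
  match h with
  | Z2_1 => \tr heat
  | Z2_g => \tr (heat *m involution_mx R N)
  end.

(* Main.v *)
Require Import Defs.
From mathcomp Require Import all_boot all_order all_fingroup all_algebra.
From mathcomp Require Import all_classical all_reals all_analysis.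
From mathcomp Require Import complex ring.
Import Order.TTheory GRing.Theory Num.Theory.
Import numFieldNormedType.Exports.
Local Open Scope ring_scope.

(** Write [L] for the Laplacian of the lift, [T] for the involution, [H] for the
    join of [G1] and [G2], [B = laplacian H + 1] and [N = N1 + N2]. The heat
    characters are exponential generating functions of the moments [\tr (L ^+ k)]
    and [\tr (L ^+ k *m T)], so it suffices to write these moments as finite
    sums of [k]-th powers ([mxtrace_expmx]).

    The middle vertex of the lift is adjacent to every other vertex, so [L] has
    the blocks [B], [-1] and [2 * N] and differs from [diag (B, 0, B)] only by
    all-ones blocks. As [B] fixes the constant vectors, all-ones blocks are
    absorbed by multiplication, and [L ^+ k] is [diag (B ^+ k, 0, B ^+ k)] plus
    explicit multiples of all-ones blocks ([expr_lift_block]). Reading off the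
    traces gives
      [\tr (L ^+ k *m T) = 0 ^+ k + (2 * N + 1) ^+ k - 1] and
      [\tr (L ^+ k) = 2 * \tr (B ^+ k) + 0 ^+ k + (2 * N + 1) ^+ k - 1].
    The swap [T] moves the two copies of [B ^+ k] off the diagonal, which is why
    they disappear from the first formula.

    The same absorption argument applies to [B], whose blocks are
    [laplacian G1 + (N2 + 1)], [laplacian G2 + (N1 + 1)] and [-1]
    ([expr_join_block]). It replaces the powers of [N2 + 1] and [N1 + 1], which
    come from the constant vectors of the two parts, by those of [1] and [N + 1].
    The remaining traces of powers of shifted Laplacians are power sums of the
    shifted roots of the characteristic polynomial ([mxtrace_expr_shift]). The
    smallest root is [0] by [spectrum_laplacian_head], and cancels against the
    replaced powers. *)

(** * Matrix exponentials and moments *)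

Lemma cvg_mx {R : realType} {m n : nat} (u : nat -> 'M[R]_(m, n))
    (l : 'M[R]_(m, n)) :
  (forall i j, ((u k i j) @[k --> \oo] --> l i j)%classic) ->
  (u k @[k --> \oo] --> l)%classic.
Proof.
move=> ul; apply/cvgrPdist_le => e e0; near=> k.
rewrite /Num.Def.normr/= mx_normrE (bigmax_le _ (ltW e0))//= => i _.
rewrite !mxE; move: i; near: k; apply: filter_forall => /= i.
exact: ((cvgrPdist_le _ _).1 (ul i.1 i.2)).
Unshelve. all: by end_near. Qed.

(** The sum of the moduli of all entries of [A] bounds every column sum of
    moduli, so one factor [A] costs at most one factor of this constant; the
    entries of [A ^+ k] thus grow at most geometrically. *)
Lemma norm_expr_mx_le {R : realType} {n : nat} (A : 'M[R]_n) k i j :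
  `|(A ^+ k) i j| <= (\sum_i' \sum_j' `|A i' j'|) ^+ k.
Proof.
set b := (X in _ <= X ^+ _).
have b0 : 0 <= b by rewrite /b sumr_ge0// => c _; rewrite sumr_ge0.
elim: k i j => [|k IH] i j.
  by rewrite !expr0 mxE; case: (i == j); rewrite ?normr1 ?normr0.
rewrite exprSr mxE (le_trans (ler_norm_sum _ _ _))//.
have colj : \sum_l `|A l j| <= b.
  rewrite /b [leRHS]exchange_big [leRHS](bigD1 j)//= lerDl sumr_ge0// => c _.
  exact: sumr_ge0.
rewrite exprSr (le_trans _ (ler_wpM2l (exprn_ge0 k b0) colj))//.
by rewrite mulr_sumr ler_sum// => l _; rewrite normrM ler_wpM2r.
Qed.

(** Each entry of the exponential series is dominated by the scalar series of
    [expR b], with [b] the sum of the moduli of the entries of [A]. *)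
Lemma cvg_expmx {R : realType} {n : nat} (A : 'M[R]_n) :
  (series (fun k => (k`!%:R)^-1 *: (A ^+ k)) K @[K --> \oo] --> expmx A)%classic.
Proof.
pose v i j : R^nat := fun k => k`!%:R^-1 * (A ^+ k) i j.
have cv i j : cvgn (series (v i j)).
  apply: normed_cvg.
  pose b := \sum_i' \sum_j' `|A i' j'|.
  apply: (@series_le_cvg _ _ (exp_coeff b)) => [k|k|k|].
  - exact: normr_ge0.
  - by apply: exp_coeff_ge0; rewrite /b sumr_ge0// => c _; rewrite sumr_ge0.
  - rewrite /v /= /exp_coeff /= normrM normfV mulrC (ger0_norm (ler0n _ _)).
    by rewrite ler_wpM2r ?invr_ge0 ?ler0n// norm_expr_mx_le.
  - exact: is_cvg_series_exp_coeff.
pose l : 'M[R]_n := \matrix_(i, j) limn (series (v i j)).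
have cl : (series (fun k => (k`!%:R)^-1 *: (A ^+ k)) K @[K --> \oo] --> l)%classic.
  apply: cvg_mx => i j; rewrite mxE.
  rewrite (_ : (fun K => _) = series (v i j)); first exact: cv.
  apply/funext => K; rewrite /series /= summxE; apply: eq_bigr => k _.
  by rewrite mxE.
by rewrite /expmx; apply: cvgP cl.
Qed.

Lemma cvg_mxtrace_mul {R : realType} {n : nat} (u : nat -> 'M[R]_n) (l T : 'M[R]_n) :
  (u k @[k --> \oo] --> l)%classic ->
  (\tr (u k *m T) @[k --> \oo] --> \tr (l *m T))%classic.
Proof.
move=> ul.
have entry i j : (u k i j @[k --> \oo] --> l i j)%classic.
  exact: (cvg_comp u (fun M : 'M[R]_n => M i j) ul (@coord_continuous R n n i j l)).
rewrite /mxtrace; apply: cvg_big => [|i _]; first exact: add_continuous.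
under eq_cvg do rewrite mxE.
rewrite mxE; apply: cvg_big => [|j _]; first exact: add_continuous.
by apply: cvgM; [exact: entry|exact: cvg_cst].
Qed.

Lemma expr_scale_mx {R : comPzRingType} {n : nat} (x : R) (A : 'M[R]_n) k :
  (x *: A) ^+ k = x ^+ k *: A ^+ k.
Proof.
elim: k => [|k IH]; first by rewrite !expr0 scale1r.
by rewrite !exprS IH -!mulmxE -scalemxAl -scalemxAr scalerA.
Qed.

(** Since the trace against [T] is continuous and linear, it suffices to know the
    moments [\tr (A ^+ k *m T)]: if they are the power sums of finitely many
    points [p.2] with weights [p.1], then the trace of the exponential is the
    same weighted sum of exponentials. No diagonalization of [A] is involved. *)
Lemma mxtrace_expmx {R : realType} {n : nat} (A T : 'M[R]_n)
    (s : seq (R * R)) (x : R) :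
  (forall k, \tr (A ^+ k *m T) = \sum_(p <- s) p.1 * p.2 ^+ k) ->
  \tr (expmx (x *: A) *m T) = \sum_(p <- s) p.1 * expR (p.2 * x).
Proof.
move=> moments.
have := cvg_mxtrace_mul _ _ T (cvg_expmx (x *: A)).
move=> /cvg_lim <-//; apply/cvg_lim => //.
rewrite (_ : (fun K => _)
  = fun K => \sum_(p <- s) p.1 * series (exp_coeff (p.2 * x)) K).
  apply: cvg_big => [|p _]; first exact: add_continuous.
  apply: cvgM; [exact: cvg_cst|exact: is_cvg_series_exp_coeff].
apply/funext => K; rewrite /series /= mulmx_suml raddf_sum /=.
under [RHS]eq_bigr do rewrite mulr_sumr.
rewrite [RHS]exchange_big; apply: eq_bigr => k _ /=.
rewrite expr_scale_mx -!scalemxAl !mxtraceZ moments !mulr_sumr.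
apply: eq_bigr => p _.
by rewrite /exp_coeff /= exprMn; ring.
Qed.

(** * Traces of powers from the characteristic polynomial *)

Lemma expr_trig_mx {F : comPzRingType} {n : nat} (A : 'M[F]_n) k :
  is_trig_mx A ->
  is_trig_mx (A ^+ k) /\ forall i, (A ^+ k) i i = A i i ^+ k.
Proof.
move=> /is_trig_mxP At; elim: k => [|k [/is_trig_mxP IH IHd]].
  split=> [|i]; first exact: scalar_mx_is_trig.
  by rewrite !expr0 mxE eqxx.
split=> [|i].
  apply/is_trig_mxP => i j ij; rewrite exprSr mxE big1// => l _.
  have [il|li] := ltnP i l; first by rewrite IH ?mul0r.
  by rewrite At ?mulr0// (leq_ltn_trans li).
rewrite !exprSr mxE (bigD1 i)//= IHd big1 ?addr0// => l.
rewrite neq_ltn => /orP[li|il]; last by rewrite IH ?mul0r.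
by rewrite At ?mulr0.
Qed.

Lemma char_poly_similar {F : fieldType} {n : nat} (P A D : 'M[F]_n) :
  P \in unitmx -> P *m A = D *m P -> char_poly A = char_poly D.
Proof.
move=> Pu PAD; have dP : \det (map_mx polyC P) != 0.
  by rewrite det_map_mx polyC_eq0 -unitfE -unitmxE.
apply: (mulfI dP); rewrite [RHS]mulrC /char_poly -!det_mulmx; congr (\det _).
rewrite /char_poly_mx mulmxBr mulmxBl -!map_mxM PAD.
by rewrite mul_scalar_mx mul_mx_scalar.
Qed.

(** Schur triangularization: conjugation changes neither the characteristic
    polynomial nor the traces of powers, and both can be read off the diagonal
    of a triangular matrix. *)
Lemma mxtrace_expr_closed {C : numClosedFieldType} {n : nat} (A : 'M[C]_n)
    (s : seq C) :
  char_poly A = \prod_(a <- s) ('X - a%:P) ->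
  forall k, \tr (A ^+ k) = \sum_(a <- s) a ^+ k.
Proof.
case: n A => [|n] A cA k.
  have /eqP : size (char_poly A) = 1%N by rewrite size_char_poly.
  rewrite cA size_prod_XsubC eqSS size_eq0 => /eqP ->.
  by rewrite big_nil /mxtrace big_ord0.
have [P /unitarymx_unit Pu Dtrig] := Schur A isT.
pose D := conjmx P A; rewrite /similar_to /= -/D in Dtrig.
have PAD : P *m A = D *m P by rewrite /D conjumx// mulmxKV.
have PADk : P *m A ^+ k = D ^+ k *m P.
  elim: k => [|k IH]; first by rewrite !expr0 [LHS]mulmx1 [RHS]mul1mx.
  by rewrite !exprSr -!mulmxE mulmxA IH -mulmxA PAD mulmxA.
have -> : A ^+ k = invmx P *m (D ^+ k *m P) by rewrite -PADk mulKmx.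
rewrite mxtrace_mulC mulmxK//.
have [_ diagDk] := expr_trig_mx D k Dtrig.
rewrite /mxtrace; under eq_bigr do rewrite diagDk.
rewrite -(big_map (fun i => D i i) predT (fun a => a ^+ k)).
apply: perm_big; apply: prod_XsubC_eq.
by rewrite big_map -cA (char_poly_similar _ _ _ Pu PAD) char_poly_trig.
Qed.

Lemma map_mx_expr {aR rR : pzRingType} (f : {rmorphism aR -> rR}) {n : nat}
    (A : 'M[aR]_n) k : map_mx f (A ^+ k) = map_mx f A ^+ k.
Proof.
elim: k => [|k IH]; first by rewrite !expr0 map_mx1.
by rewrite !exprS -!mulmxE map_mxM IH.
Qed.

(** Obtained from the algebraically closed case by extending scalars to [R[i]],
    where the embedding of [R] is injective. *)
Lemma mxtrace_expr {R : rcfType} {n : nat} (A : 'M[R]_n) (s : seq R) :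
  char_poly A = \prod_(a <- s) ('X - a%:P) ->
  forall k, \tr (A ^+ k) = \sum_(a <- s) a ^+ k.
Proof.
move=> cA k; apply: (fmorph_inj (real_complex R)).
rewrite -trace_map_mx rmorph_sum map_mx_expr /=.
rewrite (mxtrace_expr_closed _ (map (real_complex R) s)).
  by rewrite big_map; apply: eq_bigr => a _; rewrite rmorphXn.
rewrite -map_char_poly cA rmorph_prod big_map; apply: eq_bigr => a _ /=.
by rewrite rmorphB /= map_polyX map_polyC.
Qed.

Lemma mxtrace_expr_shift {R : rcfType} {n : nat} (A : 'M[R]_n) (s : seq R) (c : R) :
  char_poly A = \prod_(a <- s) ('X - a%:P) ->
  forall k, \tr ((A + c%:M) ^+ k) = \sum_(a <- s) (a + c) ^+ k.
Proof.
move=> cA k; rewrite exprDn_comm; last exact/comm_mx_scalar.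
rewrite raddf_sum /=.
under [RHS]eq_bigr do rewrite exprDn.
rewrite [RHS]exchange_big; apply: eq_bigr => i _ /=.
have -> : (c%:M : 'M[R]_n) ^+ i = (c ^+ i)%:M.
  elim: (i : nat) => [|l IH]; first by rewrite !expr0.
  by rewrite !exprS IH -mulmxE -scalar_mxM.
rewrite -mulmxE mul_mx_scalar raddfMn /= mxtraceZ (mxtrace_expr _ _ cA).
by rewrite mulr_sumr -sumrMnl; apply: eq_bigr => a _; rewrite mulrC.
Qed.

(** * Laplacians and their smallest eigenvalue *)

(** The degree as a sum over all vertices, a form which splits along block
    decompositions of the vertex set. *)
Lemma laplacianE {R : realType} {n : nat} (G : sgraph n) i j :
  laplacian R G i j = (\sum_k (G i k)%:R) *+ (i == j) - (G i j)%:R.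
Proof.
rewrite !mxE; congr (_ *+ _ - _).
rewrite -sum1_card natr_sum [RHS](bigID (fun k => G i k)) /=.
rewrite [X in _ = _ + X]big1 ?addr0; last by move=> k /negbTE ->.
by apply: eq_big => [k|k]; rewrite inE// => ->.
Qed.

Lemma laplacian_sum_row {R : realType} {n : nat} (G : sgraph n) i :
  \sum_j laplacian R G i j = 0.
Proof.
under eq_bigr do rewrite laplacianE.
rewrite big_split /= (bigD1 i)//= eqxx [X in _ + X + _]big1 ?addr0 => [|j]; last first.
  by rewrite eq_sym => /negbTE ->.
by rewrite sumrN mulr1n subrr.
Qed.

Lemma laplacian_sym {R : realType} {n : nat} (G : sgraph n) i j :
  laplacian R G i j = laplacian R G j i.
Proof.
have [->//|ij] := eqVneq i j.
by rewrite !laplacianE (adj_sym G i j) (eq_sym j i) (negbTE ij).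
Qed.

(** Let [v] be an eigenvector and [i] an index where [`|v i|] is maximal. The
    eigenvalue equation at [i] reads [(d - a) v i = \sum_(j ~ i) v j] with [d]
    the degree of [i]; by maximality [`|d - a| <= d], whence [0 <= a]. *)
Lemma laplacian_eigenvalue_ge0 {R : realType} {n : nat} (G : sgraph n) (a : R) :
  eigenvalue (laplacian R G) a -> 0 <= a.
Proof.
move=> /eigenvalueP[v vL /matrix0Pn[z [i0 vi0]]].
rewrite ord1 in vi0.
pose i := [arg max_(i > i0) `|v 0 i|]%O.
have imax j : `|v 0 j| <= `|v 0 i|.
  by rewrite /i; case: arg_maxP => // k _; apply.
have vi : 0 < `|v 0 i| by rewrite (lt_le_trans _ (imax i0)) ?normr_gt0.
pose d : R := \sum_k (G i k)%:R.
have d0 : 0 <= d by rewrite sumr_ge0.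
have eqi : (d - a) * v 0 i = \sum_j (G i j)%:R * v 0 j.
  have := congr1 (fun w : 'rV_n => w 0 i) vL; rewrite !mxE.
  under eq_bigr do rewrite laplacian_sym laplacianE mulrBr.
  rewrite sumrB (bigD1 i)//= eqxx [X in _ + X - _]big1 ?addr0 => [|j]; last first.
    by rewrite eq_sym => /negbTE ->; rewrite mulr0.
  rewrite mulr1n -/d mulrBl => <-.
  rewrite opprB mulrC addrCA subrr addr0.
  by apply: eq_bigr => j _; rewrite mulrC.
have : `|d - a| <= d.
  rewrite -(ler_pM2r vi) -normrM eqi (le_trans (ler_norm_sum _ _ _))//.
  rewrite mulr_suml ler_sum// => j _.
  by rewrite normrM ger0_norm ?ler0n// ler_wpM2l.
by rewrite ler_norml => /andP[_]; rewrite gerBl.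
Qed.

Lemma laplacian_eigenvalue0 {R : realType} {n : nat} (G : sgraph n) :
  (0 < n)%N -> eigenvalue (laplacian R G) 0.
Proof.
move=> n0; apply/eigenvalueP; exists (const_mx 1).
  apply/rowP => j; rewrite scale0r !mxE -[RHS](laplacian_sum_row G j).
  by apply: eq_bigr => i _; rewrite mxE mul1r laplacian_sym.
apply/matrix0Pn; exists 0, (Ordinal n0).
by rewrite mxE oner_neq0.
Qed.

(** The constant vector shows that [0] occurs in the spectrum, and [0] is a lower
    bound of it, so the sorted list of eigenvalues starts with [0]. *)
Lemma spectrum_laplacian_head {R : realType} {n : nat} (G : sgraph n)
    (s : n.-tuple R) :
  (0 < n)%N -> spectrum_of (laplacian R G) s -> s = 0 :: behead s :> seq R.
Proof.
move=> n0 [].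
have : size s = n by rewrite size_tuple.
case: (tval s) => [|a r] /=; first by move=> s0; rewrite -s0 in n0.
move=> _ ars cG; congr (_ :: _); apply/le_anti/andP; split.
  have := laplacian_eigenvalue0 G n0 (R := R).
  rewrite eigenvalue_root_char cG root_prod_XsubC inE => /predU1P[->//|].
  by move: ars; rewrite (path_sortedE le_trans) => /andP[/allP + _]; apply.
apply: (@laplacian_eigenvalue_ge0 R n G).
by rewrite eigenvalue_root_char cG root_prod_XsubC mem_head.
Qed.

(** * All-ones blocks *)

Lemma mul_const_mx {R : pzSemiRingType} {m n p : nat} (c d : R) :
  (const_mx c : 'M[R]_(m, n)) *m const_mx d = const_mx (c * d * n%:R)
    :> 'M[R]_(m, p).
Proof.
apply/matrixP => i j; rewrite !mxE; under eq_bigr do rewrite !mxE.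
by rewrite sumr_const card_ord mulr_natr.
Qed.

Lemma mulmx_const {R : pzSemiRingType} {n p : nat} (A : 'M[R]_n) (a c : R) :
  (forall i, \sum_j A i j = a) -> A *m const_mx c = const_mx (a * c) :> 'M[R]_(n, p).
Proof.
move=> Aa; apply/matrixP => i j; rewrite !mxE -(Aa i) mulr_suml.
by apply: eq_bigr => l _; rewrite mxE.
Qed.

Lemma const_mulmx {R : pzSemiRingType} {n p : nat} (A : 'M[R]_n) (a c : R) :
  (forall j, \sum_i A i j = a) -> const_mx c *m A = const_mx (c * a) :> 'M[R]_(p, n).
Proof.
move=> Aa; apply/matrixP => i j; rewrite !mxE -(Aa j) mulr_sumr.
by apply: eq_bigr => l _; rewrite mxE.
Qed.

Lemma expr_mx_sum_row {R : pzSemiRingType} {n : nat} (A : 'M[R]_n) (a : R) k i :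
  (forall i, \sum_j A i j = a) -> \sum_j (A ^+ k) i j = a ^+ k.
Proof.
move=> Aa.
have eqk : A ^+ k *m const_mx 1 = const_mx (a ^+ k) :> 'cV[R]_n.
  elim: k => [|k IH]; first by rewrite !expr0 [LHS]mul1mx.
  rewrite exprS -mulmxE -mulmxA IH (mulmx_const _ _ _ Aa).
  by rewrite exprS.
have := congr1 (fun w : 'cV_n => w i 0) eqk; rewrite !mxE => <-.
by apply: eq_bigr => j _; rewrite mxE mulr1.
Qed.

Lemma add_const_mx {R : nmodType} {m n : nat} (c d : R) :
  const_mx c + const_mx d = const_mx (c + d) :> 'M[R]_(m, n).
Proof. by apply/matrixP => i j; rewrite !mxE. Qed.

Lemma const_mx0 {R : nmodType} {m n : nat} : const_mx 0 = 0 :> 'M[R]_(m, n).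
Proof. by apply/matrixP => i j; rewrite !mxE. Qed.

(** * Powers of the Laplacian of a join *)

(** The matrix [block_mx A (-J) (-J) B] of [expr_join_block] preserves the vectors
    that are constant on each of the two parts, of sizes [M] and [N]. On them it
    has the eigenvalues [1] (constant vector) and [M + N + 1] (vector [N] on the
    first part, [-M] on the second), whereas the diagonal part [A (+) B] has
    [N + 1] and [M + 1]. The coefficients [join_diag] and [join_off] of the
    all-ones blocks are the differences of the corresponding spectral
    projections, weighted by [k]-th powers. *)
Definition join_diag {F : fieldType} (M N : F) (k : nat) : F :=
  (1 + (M + N + 1) ^+ k * (N / M)) / (M + N) - (N + 1) ^+ k / M.

Definition join_off {F : fieldType} (M N : F) (k : nat) : F :=
  (1 - (M + N + 1) ^+ k) / (M + N).

Lemma join_off_sym {F : fieldType} (M N : F) k : join_off M N k = join_off N M k.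
Proof. by rewrite /join_off [M + N]addrC. Qed.

Lemma join_diag0 {F : fieldType} (M N : F) :
  M != 0 -> M + N != 0 -> join_diag M N 0 = 0.
Proof. by move=> M0 MN0; rewrite /join_diag !expr0; field; rewrite M0. Qed.

Lemma join_diagS {F : fieldType} (M N : F) k :
  M != 0 -> M + N != 0 ->
  join_diag M N k.+1 = join_diag M N k * (N + 1) + join_off M N k * -1 * N.
Proof.
move=> M0 MN0; rewrite /join_diag /join_off !exprS.
by move: (_ ^+ k) (_ ^+ k) => p q; field; rewrite MN0 M0.
Qed.

Lemma join_offS {F : fieldType} (M N : F) k :
  M != 0 -> M + N != 0 ->
  join_off M N k.+1 = (N + 1) ^+ k * -1
    + (join_diag M N k * -1 * M + join_off M N k * (M + 1)).
Proof.
move=> M0 MN0; rewrite /join_diag /join_off !exprS.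
by move: (_ ^+ k) (_ ^+ k) => p q; field; rewrite ?M0 ?MN0.
Qed.

(** Since [A] and [B] have constant row and column sums, multiplying an all-ones
    block by [A] or [B] only rescales it. Hence every power is the power of the
    diagonal part plus all-ones blocks, whose coefficients obey a linear
    recursion in [k]. *)
Lemma expr_join_block {F : fieldType} {m n : nat} (A : 'M[F]_m) (B : 'M[F]_n)
    (M N : F) k :
  M = m%:R -> N = n%:R -> M != 0 -> N != 0 -> M + N != 0 ->
  (forall i, \sum_j A i j = N + 1) -> (forall j, \sum_i A i j = N + 1) ->
  (forall i, \sum_j B i j = M + 1) -> (forall j, \sum_i B i j = M + 1) ->
  block_mx A (const_mx (-1)) (const_mx (-1)) B ^+ k
  = block_mx (A ^+ k + const_mx (join_diag M N k)) (const_mx (join_off M N k))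
             (const_mx (join_off M N k)) (B ^+ k + const_mx (join_diag N M k)).
Proof.
move=> eM eN M0 N0 MN0 Ar Ac Br Bc.
have NM0 : N + M != 0 by rewrite addrC.
elim: k => [|k IH].
  rewrite !join_diag0// /join_off expr0 subrr mul0r.
  by rewrite !expr0 [LHS](@scalar_mx_block _ m n 1) !const_mx0 !addr0.
rewrite exprSr IH -mulmxE mulmx_block !mulmxDl.
have rowA := expr_mx_sum_row A (N + 1) k ^~ Ar.
have rowB := expr_mx_sum_row B (M + 1) k ^~ Br.
rewrite !(const_mulmx _ _ _ Ac) !(const_mulmx _ _ _ Bc).
rewrite !(mulmx_const _ _ _ rowA) !(mulmx_const _ _ _ rowB) !mul_const_mx.
rewrite -[A ^+ k *m A]exprSr -[B ^+ k *m B]exprSr [X in block_mx _ _ _ X]addrCA.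
rewrite -!addrA !add_const_mx -eM -eN.
have offS' : join_off M N k * (N + 1)
    + ((M + 1) ^+ k * -1 + join_diag N M k * -1 * N) = join_off M N k.+1.
  by rewrite !(join_off_sym M N) join_offS//; ring.
rewrite offS' -join_offS// -join_diagS//.
congr (block_mx _ _ _ (_ + const_mx _)); rewrite join_diagS// (join_off_sym N M); ring.
Qed.

(** * Powers of the Laplacian of a lift *)

(** The matrix [lift_block B 0 (-1) (2 * N)], with [B] of row and column sums
    [1], preserves the span of the constants on the two copies and the middle
    vertex. There its eigenvalues are [0] (constant vector), [2 * N + 1]
    (vector [1] on the copies, [-2 * N] in the middle) and [1] (opposite
    constants on the copies), whereas [diag (B, 0, B)] has [1], [1] and [0]. The
    coefficients [lift_corner], [lift_edge] and [lift_center] are the entries of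
    the difference between the [k]-th power and [diag (B ^+ k, 0, B ^+ k)], whose
    middle entry is [0] even for [k = 0]; hence [lift_center N 0 = 1]. *)
Definition lift_corner {F : fieldType} (N : F) (k : nat) : F :=
  (0 ^+ k + (2 * N + 1) ^+ k / (2 * N)) / (2 * N + 1) - (2 * N)^-1.

Definition lift_edge {F : fieldType} (N : F) (k : nat) : F :=
  (0 ^+ k - (2 * N + 1) ^+ k) / (2 * N + 1).

Definition lift_center {F : fieldType} (N : F) (k : nat) : F :=
  (0 ^+ k + 2 * N * (2 * N + 1) ^+ k) / (2 * N + 1).

Lemma lift_cornerS {F : fieldType} (N : F) k : 2 * N + 1 != 0 -> 2 * N != 0 ->
  lift_corner N k.+1 = lift_corner N k + lift_edge N k * -1.
Proof.
rewrite mulf_eq0 negb_or => c0 /andP[t0 N0].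
rewrite /lift_corner /lift_edge !exprS.
by move: (_ ^+ k) (_ ^+ k) => p q; field; rewrite ?c0 ?N0 ?t0.
Qed.

Lemma lift_edgeS {F : fieldType} (N : F) k : 2 * N + 1 != 0 ->
  lift_edge N k.+1 = lift_edge N k + lift_center N k * -1.
Proof.
move=> c0; rewrite /lift_center /lift_edge !exprS.
by move: (_ ^+ k) (_ ^+ k) => p q; field; rewrite ?c0.
Qed.

(** The recursion seen from the column of the middle vertex, as opposed to its row
    in [lift_edgeS]; both agree because the powers remain symmetric in these
    positions. *)
Lemma lift_edgeS' {F : fieldType} (N : F) k : 2 * N + 1 != 0 -> 2 * N != 0 ->
  lift_edge N k.+1 = -1 + lift_corner N k * -1 * N
    + (lift_edge N k * (2 * N) + lift_corner N k * -1 * N).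
Proof.
rewrite mulf_eq0 negb_or => c0 /andP[t0 N0].
rewrite /lift_corner /lift_edge !exprS.
by move: (_ ^+ k) (_ ^+ k) => p q; field; rewrite ?c0 ?N0 ?t0.
Qed.

Lemma lift_centerS {F : fieldType} (N : F) k : 2 * N + 1 != 0 ->
  lift_center N k.+1 = lift_edge N k * -1 * N
    + (lift_center N k * (2 * N) + lift_edge N k * -1 * N).
Proof.
move=> c0; rewrite /lift_center /lift_edge !exprS.
by move: (_ ^+ k) (_ ^+ k) => p q; field; rewrite ?c0.
Qed.

(** The same coefficient [x] sits in all four blocks indexed by the two copies:
    vectors that the swap of the copies sends to their opposites see only [B],
    so the corrections inside and across the copies must cancel on them. *)
Definition lift_block {R : nmodType} {n : nat} (B : 'M[R]_n) (x y z : R) :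
    'M[R]_(n + (1 + n)) :=
  block_mx (B + const_mx x) (row_mx (const_mx y) (const_mx x))
           (col_mx (const_mx y) (const_mx x))
           (block_mx (const_mx z) (const_mx y) (const_mx y) (B + const_mx x)).

Lemma expr_lift_block {F : fieldType} {n : nat} (B : 'M[F]_n) (N : F) k :
  N = n%:R -> 2 * N + 1 != 0 -> 2 * N != 0 ->
  (forall i, \sum_j B i j = 1) -> (forall j, \sum_i B i j = 1) ->
  lift_block B 0 (-1) (2 * N) ^+ k
  = lift_block (B ^+ k) (lift_corner N k) (lift_edge N k) (lift_center N k).
Proof.
move=> eN c0 N0 Br Bc; elim: k => [|k IH].
  have -> : lift_corner N 0 = 0.
    move: N0; rewrite mulf_eq0 negb_or => /andP[t0 N0].
    by rewrite /lift_corner !expr0; field; rewrite ?t0 ?N0 ?c0.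
  have -> : lift_edge N 0 = 0 by rewrite /lift_edge !expr0 subrr mul0r.
  have -> : lift_center N 0 = 1.
    by rewrite /lift_center !expr0 mulr1 addrC divff.
  rewrite /lift_block !expr0 !const_mx0 row_mx0 col_mx0 addr0.
  rewrite [LHS](@scalar_mx_block _ n (1 + n) 1) scalar_mx_block.
  congr (block_mx _ _ _ (block_mx _ _ _ _)).
  by apply/matrixP => i j; rewrite !mxE !ord1.
have rowB := expr_mx_sum_row B 1 k ^~ Br.
rewrite exprSr IH -mulmxE /lift_block !const_mx0 !addr0.
rewrite mulmx_block mul_row_col mul_row_block mul_block_col mul_col_row mulmx_block.
rewrite mul_mx_row mul_col_mx.
rewrite ?mulmx0 ?mul0mx ?addr0 ?add0r !mulmxDl.
rewrite !(const_mulmx _ _ _ Bc) !(mulmx_const _ _ _ rowB) !mul_const_mx.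
rewrite ?mulmx0 ?mul0mx ?addr0 ?add0r expr1n ?mulr1 ?mul1r -eN.
rewrite -[B ^+ k *m B]exprSr.
rewrite add_row_mx add_col_mx add_block_mx !add0r.
rewrite (addrCA (const_mx _) (B ^+ k.+1)) -[X in block_mx X]addrA !add_const_mx.
rewrite -lift_cornerS// -lift_edgeS'// -lift_edgeS// -lift_centerS//.
rewrite [_ * -1 + lift_corner N k]addrC -lift_cornerS//.
rewrite [_ * -1 + lift_edge N k]addrC -lift_edgeS//.
have edgeS : lift_corner N k * -1 * N
    + (lift_edge N k * (2 * N) + (-1 + lift_corner N k * -1 * N))
    = lift_edge N k.+1 by rewrite lift_edgeS'//; ring.
by rewrite edgeS.
Qed.

Lemma trace_const_mx {F : pzSemiRingType} {n : nat} (c : F) :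
  \tr (const_mx c : 'M[F]_n) = c * n%:R.
Proof.
by rewrite /mxtrace; under eq_bigr do rewrite mxE;
  rewrite sumr_const card_ord mulr_natr.
Qed.

Lemma trace_lift_block {F : comNzRingType} {n : nat} (B : 'M[F]_n) (x y z : F) :
  \tr (lift_block B x y z) = 2 * (\tr B + x * n%:R) + z.
Proof.
rewrite /lift_block !mxtrace_block !mxtraceD !trace_const_mx; ring.
Qed.

Lemma split_lshift {m n : nat} (i : 'I_m) :
  fintype.split (lshift n i : 'I_(m + n)) = inl i.
Proof. exact: (unsplitK (inl i)). Qed.

Lemma split_rshift {m n : nat} (i : 'I_n) :
  fintype.split (rshift m i : 'I_(m + n)) = inr i.
Proof. exact: (unsplitK (inr i)). Qed.

(** Entries of block matrices at shifted indices, together with the equality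
    tests between such indices. *)
Definition blockE :=
  (block_mxEul, block_mxEur, block_mxEdl, block_mxEdr,
   row_mxEl, row_mxEr, col_mxEu, col_mxEd,
   eq_lshift, eq_rshift, eq_lrshift, eq_rlshift).

Lemma involution_mxE {R : realType} {n : nat} :
  involution_mx R n
  = block_mx 0 (row_mx 0 1%:M) (col_mx 0 1%:M) (block_mx 1%:M 0 0 0).
Proof.
apply/matrixP => u v; rewrite 2!mxE permE /lift_swap /lift_view.
case: (split_ordP u) => [i ->|w ->]; rewrite ?split_lshift ?split_rshift;
  [|case: (split_ordP w) => [? ->|i ->]; rewrite ?split_lshift ?split_rshift];
  (case: (split_ordP v) => [j ->|x ->];
   [|case: (split_ordP x) => [? ->|j ->]]);
  rewrite ?(blockE, mxE) //.
Qed.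

Lemma trace_lift_block_involution {R : realType} {n : nat} (B : 'M[R]_n)
    (x y z : R) :
  \tr (lift_block B x y z *m involution_mx R n) = 2 * (x * n%:R) + z.
Proof.
rewrite involution_mxE /lift_block mulmx_block mxtrace_block.
rewrite mulmx0 add0r mul_row_col mul_col_row mulmx_block.
rewrite ?mulmx0 ?mulmx1 ?add0r ?addr0 mxtraceD !mxtrace_block !trace_const_mx.
ring.
Qed.

(** * The Laplacians of joins and lifts in blocks *)

Lemma join_relE {m n : nat} (G : sgraph m) (H : sgraph n) :
  (forall i j, join_rel G H (lshift n i) (lshift n j) = G i j) *
  (forall i j, join_rel G H (lshift n i) (rshift m j) = true) *
  (forall i j, join_rel G H (rshift m i) (lshift n j) = true) *
  (forall i j, join_rel G H (rshift m i) (rshift m j) = H i j).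
Proof.
by do !split=> *; rewrite /join_rel ?split_lshift ?split_rshift.
Qed.

(** Adding the identity accounts for the loops: this is the block which the
    Laplacian of the lift carries on each copy. *)
Lemma laplacian_join {R : realType} {m n : nat} (G : sgraph m) (H : sgraph n) :
  laplacian R (graph_join G H) + 1%:M
  = block_mx (laplacian R G + (n%:R + 1)%:M) (const_mx (-1))
             (const_mx (-1)) (laplacian R H + (m%:R + 1)%:M).
Proof.
have degl i : \sum_k (join_rel G H (lshift n i) k)%:R
    = \sum_k (G i k)%:R + n%:R :> R.
  rewrite big_split_ord /=; under eq_bigr do rewrite join_relE.
  under [X in _ + X]eq_bigr do rewrite join_relE.
  by rewrite sumr_const card_ord.
have degr i : \sum_k (join_rel G H (rshift m i) k)%:R
    = m%:R + \sum_k (H i k)%:R :> R.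
  rewrite big_split_ord /=; under eq_bigr do rewrite join_relE.
  under [X in _ + X]eq_bigr do rewrite join_relE.
  by rewrite sumr_const card_ord.
apply/matrixP => u v; rewrite mxE laplacianE [in LHS]mxE /=.
case: (split_ordP u) => i -> {u}; case: (split_ordP v) => j -> {v};
  rewrite join_relE !blockE ?degl ?degr.
- rewrite mxE laplacianE mxE; case: (i == j); rewrite /= ?mulr1n ?mulr0n; ring.
- by rewrite mxE /= !mulr0n; ring.
- by rewrite mxE /= !mulr0n; ring.
- rewrite mxE laplacianE mxE; case: (i == j); rewrite /= ?mulr1n ?mulr0n; ring.
Qed.

Lemma lift_viewE {n : nat} :
  (forall i : 'I_n, lift_view (lshift (1 + n) i) = Copy1 i) *
  (forall a : 'I_1, lift_view (rshift n (lshift n a)) = Middle n) *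
  (forall i : 'I_n, lift_view (rshift n (rshift 1 i)) = Copy2 i).
Proof.
by do !split=> *; rewrite /lift_view ?split_lshift ?split_rshift ?split_lshift.
Qed.

Lemma laplacian_lift_full {R : realType} {n : nat} (H : sgraph n) :
  laplacian R (acikmese_lift (full_loop H))
  = lift_block (laplacian R H + 1%:M) 0 (-1) (2 * n%:R).
Proof.
have deg u : \sum_k (lift_rel (full_loop H) u k)%:R =
    (match lift_view u with
     | Copy1 i | Copy2 i => \sum_k (H i k)%:R + 1
     | Middle => 2 * n%:R end) :> R.
  rewrite 2!big_split_ord /= big_ord1 /lift_rel.
  under eq_bigr do rewrite lift_viewE.
  under [X in _ + (_ + X)]eq_bigr do rewrite lift_viewE.
  rewrite lift_viewE /=; case: (lift_view u) => [i||i]; rewrite ?inE ?big1_eq.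
  - by rewrite addr0.
  - have -> : \sum_(i < n) (i \in [set: 'I_n]%SET)%:R = n%:R :> R.
      rewrite (eq_bigr (fun=> 1)) ?sumr_const ?card_ord// => i _.
      by rewrite finset.in_setT.
    by rewrite /= add0r; ring.
  - by rewrite add0r addrC.
apply/matrixP => u v; rewrite laplacianE deg /= /lift_rel /lift_block.
case: (split_ordP u) => [i ->|w ->]; [|case: (split_ordP w) => [a ->|i ->]];
  (case: (split_ordP v) => [j ->|x ->];
   [|case: (split_ordP x) => [b ->|j ->]]); rewrite ?lift_viewE ?blockE /=.
- rewrite [RHS]mxE [X in _ = X + _]mxE laplacianE !mxE.
  by case: (i == j); rewrite /= ?mulr1n ?mulr0n; ring.
- by rewrite mxE finset.inE /=; ring.
- by rewrite mxE; ring.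
- by rewrite mxE finset.inE /=; ring.
- by rewrite mxE !ord1 eqxx /=; ring.
- by rewrite mxE finset.inE /=; ring.
- by rewrite mxE; ring.
- by rewrite mxE finset.inE /=; ring.
- rewrite [RHS]mxE [X in _ = X + _]mxE laplacianE !mxE.
  by case: (i == j); rewrite /= ?mulr1n ?mulr0n; ring.
Qed.

(** * Moments *)

Lemma laplacian_shift_sum_row {R : realType} {n : nat} (G : sgraph n) (c : R) i :
  \sum_j (laplacian R G + c%:M) i j = c.
Proof.
under eq_bigr do rewrite mxE; rewrite big_split /= laplacian_sum_row add0r.
rewrite (bigD1 i)//= mxE eqxx big1 ?addr0// => j.
by rewrite eq_sym mxE => /negbTE ->.
Qed.

Lemma laplacian_shift_sum_col {R : realType} {n : nat} (G : sgraph n) (c : R) j :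
  \sum_i (laplacian R G + c%:M) i j = c.
Proof.
rewrite -[RHS](laplacian_shift_sum_row G c j); apply: eq_bigr => i _.
by rewrite mxE [RHS]mxE laplacian_sym !mxE eq_sym.
Qed.

Lemma join_diag_trace {F : fieldType} (M N : F) k :
  M != 0 -> N != 0 -> M + N != 0 ->
  join_diag M N k * M + join_diag N M k * N
  = 1 + (M + N + 1) ^+ k - (N + 1) ^+ k - (M + 1) ^+ k.
Proof.
move=> M0 N0 MN0; rewrite /join_diag [N + M]addrC.
move: (_ ^+ k) (_ ^+ k) (_ ^+ k) => p q r.
by field; rewrite ?M0 ?N0 ?MN0.
Qed.

(** Both equivariant moments of the lift contain this contribution of the all-ones
    blocks. *)
Lemma lift_trace {F : fieldType} (N : F) k : 2 * N + 1 != 0 -> 2 * N != 0 ->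
  2 * (lift_corner N k * N) + lift_center N k = 0 ^+ k + (2 * N + 1) ^+ k - 1.
Proof.
rewrite mulf_eq0 negb_or => c0 /andP[t0 N0].
rewrite /lift_corner /lift_center.
by move: (_ ^+ k) (_ ^+ k) => p q; field; rewrite ?c0 ?N0 ?t0.
Qed.

(** The eigenvalue [0] is split off as the summand [c ^+ k]; it belongs to the
    constant vector, on which joining changes the matrix. *)
Lemma trace_laplacian_expr {R : realType} {n : nat} (G : sgraph n)
    (s : n.-tuple R) (c : R) k :
  (0 < n)%N -> spectrum_of (laplacian R G) s ->
  \tr ((laplacian R G + c%:M) ^+ k) = c ^+ k + \sum_(a <- behead s) (a + c) ^+ k.
Proof.
move=> n0 sG; rewrite (mxtrace_expr_shift _ _ _ sG.2).
by rewrite (spectrum_laplacian_head _ _ n0 sG) big_cons add0r.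
Qed.

Lemma trace_join_expr {R : realType} {m n : nat} (G : sgraph m) (H : sgraph n)
    (s : m.-tuple R) (r : n.-tuple R) k :
  (0 < m)%N -> (0 < n)%N ->
  spectrum_of (laplacian R G) s -> spectrum_of (laplacian R H) r ->
  \tr ((laplacian R (graph_join G H) + 1%:M) ^+ k)
  = 1 + (m%:R + n%:R + 1) ^+ k
    + \sum_(a <- behead s) (a + (n%:R + 1)) ^+ k
    + \sum_(b <- behead r) (b + (m%:R + 1)) ^+ k.
Proof.
move=> m0 n0 sG rH.
have M0 : m%:R != 0 :> R by rewrite pnatr_eq0 -lt0n.
have N0 : n%:R != 0 :> R by rewrite pnatr_eq0 -lt0n.
have MN0 : m%:R + n%:R != 0 :> R by rewrite -natrD pnatr_eq0 -lt0n addn_gt0 m0.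
rewrite laplacian_join (expr_join_block _ _ _ _ k erefl erefl M0 N0 MN0);
  try exact: laplacian_shift_sum_row; try exact: laplacian_shift_sum_col.
rewrite mxtrace_block !mxtraceD !trace_const_mx.
rewrite (trace_laplacian_expr _ _ _ _ m0 sG) (trace_laplacian_expr _ _ _ _ n0 rH).
rewrite addrACA join_diag_trace//; ring.
Qed.

(** * The heat characters *)

Lemma big_behead {V R : nmodType} {n : nat} (s : n.-tuple R) (F : R -> V) :
  \sum_(a <- behead s) F a = \sum_(1 <= i < n) F s`_i.
Proof.
case: s => [[|a r] /= /eqP <-]; first by rewrite big_nil big_geq.
by rewrite big_add1 /= (big_nth 0).
Qed.

(* Tuples are numbered from 0, so the sums over 1 <= i < N1 and 1 <= j < N2
   omit exactly the smallest Laplacian eigenvalue. *)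
Theorem proposition5p17 (R : realType) (N1 N2 : nat)
    (G1 : sgraph N1) (G2 : sgraph N2)
    (alpha : N1.-tuple R) (beta : N2.-tuple R) :
  (0 < N1)%N -> (0 < N2)%N ->
  spectrum_of (laplacian R G1) alpha ->
  spectrum_of (laplacian R G2) beta ->
  let N := (N1 + N2)%N in
  let K := loop_join (full_loop G1) (full_loop G2) in
  forall t : R, 0 < t ->
    heat_character K t Z2_g
      = 1 + expR (- (2 * N + 1)%:R * t) - expR (- t)
    /\
    heat_character K t Z2_1
      = 1 + expR (- (2 * N + 1)%:R * t) + expR (- t)
        + 2 * expR (- (N + 1)%:R * t)
        + 2 * (\sum_(1 <= i < N1) expR (- (alpha`_i + N2%:R + 1) * t))
        + 2 * (\sum_(1 <= j < N2) expR (- (beta`_j + N1%:R + 1) * t)).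
Proof.
move=> N1_gt0 N2_gt0 specG1 specG2 N K t _.
have N_gt0 : (0 < N)%N by rewrite addn_gt0 N1_gt0.
have two_N : 2 * N%:R != 0 :> R by rewrite -natrM pnatr_eq0 -lt0n muln_gt0.
have two_N1 : 2 * N%:R + 1 != 0 :> R by rewrite -natrM natr1 pnatr_eq0.
rewrite /K loop_join_full /heat_character laplacian_lift_full.
pose H := graph_join G1 G2; rewrite -/H.
set L := lift_block _ _ _ _.
have powL k : L ^+ k = lift_block ((laplacian R H + 1%:M) ^+ k)
    (lift_corner N%:R k) (lift_edge N%:R k) (lift_center N%:R k).
  by apply: expr_lift_block => // i;
    [exact: laplacian_shift_sum_row|exact: laplacian_shift_sum_col].
have eqN1 : (N + 1)%:R = N%:R + 1 :> R by rewrite natrD.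
have eq2N1 : (2 * N + 1)%:R = 2 * N%:R + 1 :> R by rewrite natrD natrM.
have rate c : expR (- c%:R * t) = expR (c%:R * - t) by congr expR; ring.
split.
  (* The points are eigenvalues of [L], the weights traces of [T] on the
     eigenspaces, those of trace zero being absent; in the zeroth moment the
     point 0 counts as [0 ^+ 0 = 1]. *)
  rewrite (mxtrace_expmx _ _ [:: (1, 0); (1, 2 * N%:R + 1); (-1, 1)]) => [|k].
    rewrite !big_cons big_nil /= rate eq2N1 mul0r expR0 !mul1r mulN1r.
    by rewrite addr0 addrA.
  rewrite powL trace_lift_block_involution lift_trace// !big_cons big_nil /=.
  by rewrite expr1n; ring.
(* The full trace is the trace against the identity. *)
rewrite -[expmx _]mulmx1.
rewrite (mxtrace_expmx _ _ ([:: (1, 0); (1, 2 * N%:R + 1); (1, 1); (2, N%:R + 1)]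
  ++ [seq (2, a + (N2%:R + 1)) | a <- behead alpha]
  ++ [seq (2, b + (N1%:R + 1)) | b <- behead beta])) => [|k].
  have sumE n (s : n.-tuple R) c :
      \sum_(a <- behead s) expR ((a + (c + 1)) * - t)
      = \sum_(1 <= i < n) expR (- (s`_i + c + 1) * t).
    rewrite big_behead; apply: eq_bigr => i _; congr expR; ring.
  rewrite !big_cat !big_map !big_cons big_nil /= -!mulr_sumr !sumE !rate.
  by rewrite eqN1 eq2N1 mul0r expR0 !mul1r addr0; ring.
rewrite mulmx1 powL trace_lift_block mulrDr -addrA lift_trace//.
rewrite (trace_join_expr _ _ _ _ k N1_gt0 N2_gt0 specG1 specG2).
rewrite !big_cat !big_map !big_cons big_nil /= -!mulr_sumr expr1n -natrD -/N.
ring.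
Qed.
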